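(* There exist absolute constants $C,k>0$ such that the following holds. Let $K$ be a positive number, and let $A$ and $B$ be finite nonempty subsets of a commutative group such that $|B|\le|A|$ and $E(A,B)=(|A||B|)^{3/2}/K$. Write $\Lambda=C(1+\log|A|)^k$. Then there exist subsets $A'\subseteq A$ and $B'\subseteq B$ such that \[ |A'|\ \ge\ \Lambda^{-1}\frac{|A|}{K}\qquad\text{and}\qquad |B'|\ \ge\ \Lambda^{-1}\frac{|B|}{K}, \] and \[ |A'+B'|\ \le\ \Lambda K^3(|A||B|)^{1/2}\qquad\text{and}\qquad K^3(|A||B|)^{1/2}\ \le\ \Lambda K^4(|A'||B'|)^{1/2}. \]
   Context: For finite subsets $A,B$ of a commutative group (written additively), the additive energy is $E(A,B)=|\{(a_1,a_2,b_1,b_2)\in A\times A\times B\times B: a_1-a_2=b_1-b_2\}|$, and $A'+B'=\{a+b:a\in A',b\in B'\}$. *)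

(* Defs.v *)
From mathcomp Require Import all_boot all_order all_algebra finmap.
Import GRing.Theory.

Set Implicit Arguments.
Unset Strict Implicit.
Unset Printing Implicit Defensive.

Local Open Scope fset_scope.
Local Open Scope ring_scope.

(* Finite subsets of a commutative group, possibly infinite and written
   additively, are finite sets over a zmodType. *)

(* The quadruple (a1, a2, b1, b2) is encoded as ((a1, a2), (b1, b2)). *)
Definition additive_energy (V : zmodType) (A B : {fset V}) : nat :=
  #|` [fset q in (A `*` A) `*` (B `*` B)
       | q.1.1 - q.1.2 == q.2.1 - q.2.2 ] |.

Definition sumset (V : zmodType) (A B : {fset V}) : {fset V} :=
  [fset a + b | a in A, b in B].

(* Main.v *)
(* Balog-Szemeredi-Gowers with logarithmic losses. Write N = (|A||B|)^(1/2). The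
   energy is the sum over pairs (a, b) of the number r(a, b) of representations
   of a + b, so some dyadic level t satisfies E <= 2 L t e, where
   L = O(1 + log |A|) and e is the number of pairs with r >= t. These pairs form
   a bipartite graph G of density d = e / N^2 whose set S of edge sums satisfies
   t |S| <= e; hence d >= 1 / (2 L K) and |S| <= 2 L K d^2 N. The graph lemma gives
   A' and B' of relative density at least d/8 such that any a in A' and b in B'
   are joined by at least d^5 N^2 / 4096 paths of length three. Each element of
   A' + B' thus yields that many triples in S, all distinct, so
   |A' + B'| <= 4096 |S|^3 / (d^5 N^2) = O(L^3 K^3 d N). *)
Require Import Defs.
From mathcomp Require Import all_boot all_order all_algebra finmap.
From mathcomp Require Import reals exp lra ring.
Import Order.TTheory GRing.Theory Num.Theory.

Set Implicit Arguments.
Unset Strict Implicit.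
Unset Printing Implicit Defensive.

Local Open Scope fset_scope.
Local Open Scope ring_scope.

(** * Indicator sums and paths of length three in dense bipartite graphs *)

Lemma sum_indicator (R : pzSemiRingType) (T : finType) (D P : pred T) :
  \sum_(i | D i) (P i)%:R = #|[set i | D i && P i]|%:R :> R.
Proof.
rewrite -natr_sum big_mkcond /= -sum1_card natr_sum -natr_sum; congr _%:R.
rewrite [RHS]big_mkcond /=; apply: eq_bigr => i _; rewrite inE.
by case: (D i); case: (P i).
Qed.

Lemma sum_cst (R : pzSemiRingType) (T : finType) (c : R) :
  \sum_(i : T) c = c * #|T|%:R.
Proof. by rewrite sumr_const mulr_natr. Qed.

Ltac positivity := solve [repeat match goal with
  | |- is_true (0 < _%:R) => rewrite ltr0n //
  | |- is_true (0 <= _%:R) => exact: ler0n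
  | |- is_true (0 < _ * _) => apply: mulr_gt0
  | |- is_true (0 <= _ * _) => apply: mulr_ge0
  | |- is_true (0 < _ ^+ _) => apply: exprn_gt0
  | |- is_true (0 <= _ ^+ _) => apply: exprn_ge0
  | |- is_true (0 < _^-1) => rewrite invr_gt0
  | |- is_true (0 <= _^-1) => rewrite invr_ge0
  | H : is_true (0 < ?x) |- is_true (0 < ?x) => exact: H
  | H : is_true (0 <= ?x) |- is_true (0 <= ?x) => exact: H
  | H : is_true (0 < ?x) |- is_true (0 <= ?x) => exact: ltW H
  end].

(** Inside a neighbourhood with few pairs of small codegree, [A] keeps the vertices with few bad
    partners and [B] takes the vertices of [Y] with many neighbours there. Most such neighbours of
    [b] are good partners of [a], and each supplies many paths. *)
Lemma many_3paths (R : realFieldType) (X Y : finType) (G : X -> Y -> bool)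
    (d : R) :
  0 < d -> (0 < #|X|)%N -> (0 < #|Y|)%N ->
  d * #|X|%:R * #|Y|%:R <= #|[set p : X * Y | G p.1 p.2]|%:R ->
  exists (A : {set X}) (B : {set Y}),
    [/\ d / 8 * #|X|%:R <= #|A|%:R, d / 4 * #|Y|%:R <= #|B|%:R &
        {in A & B, forall a b,
          d ^+ 5 / 4096 * #|X|%:R * #|Y|%:R <=
          #|[set p : X * Y | [&& G a p.2, G p.1 p.2 & G p.1 b]]|%:R}].
Proof.
move=> d0 X0 Y0.
have xp : 0 < #|X|%:R :> R by rewrite ltr0n.
have yp : 0 < #|Y|%:R :> R by rewrite ltr0n.
set x : R := #|X|%:R in xp *; set y : R := #|Y|%:R in yp *.
move=> edges.
pose deg a : R := \sum_b (G a b)%:R.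
pose codeg a a' : R := \sum_b (G a b && G a' b)%:R.
have sum_deg : \sum_a deg a = #|[set p : X * Y | G p.1 p.2]|%:R.
  by rewrite pair_bigA /= sum_indicator.
pose X1 := [set a | d / 2 * y <= deg a].
(* Vertices of degree below [d / 2 * y] carry at most half of the guaranteed edges. *)
have sum_deg1 : d / 2 * x * y <= \sum_(a in X1) deg a.
  have : \sum_a deg a = \sum_(a in X1) deg a + \sum_(a | a \notin X1) deg a.
    by rewrite (bigID (mem X1)).
  have : \sum_(a | a \notin X1) deg a <= \sum_(a : X) d / 2 * y.
    rewrite big_mkcond; apply: ler_sum => a _; case: ifPn => [|_].
      by rewrite inE -ltNge => /ltW.
    positivity.
  rewrite sum_cst -/x sum_deg.
  move=> h1 h2; move: edges; rewrite -/x -/y; lra.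
pose X2 b := [set a in X1 | G a b].
pose n b : R := #|X2 b|%:R.
have sum_n : \sum_b n b = \sum_(a in X1) deg a.
  rewrite exchange_big /=; apply: eq_bigr => b _.
  by rewrite sum_indicator /n /X2.
(* The threshold makes the average of [W] at most half of [d / 16 * (d / 2 * x) ^+ 2], where
   [d / 2 * x] bounds the average of [n] from below. *)
pose bad a a' := codeg a a' < d ^+ 3 / 128 * y.
pose W b : R := \sum_(a in X2 b) \sum_(a' in X2 b) (bad a a')%:R.
have sum_W : \sum_b W b <= d ^+ 3 / 128 * x ^+ 2 * y.
  have -> : \sum_b W b =
      \sum_(a in X1) \sum_(a' in X1) (bad a a')%:R * codeg a a'.
    have WE b : W b = \sum_(a in X1) \sum_(a' in X1)
        (bad a a')%:R * (G a b && G a' b)%:R.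
      rewrite /W big_mkcond [RHS]big_mkcond; apply: eq_bigr => a _.
      rewrite inE; case: (a \in X1) => //=; case Gab: (G a b) => /=; last first.
        by rewrite big1 // => a' _; rewrite mulr0.
      rewrite big_mkcond [RHS]big_mkcond; apply: eq_bigr => a' _.
      rewrite inE; case: (a' \in X1) => //=.
      by case: (G a' b); rewrite ?mulr1 ?mulr0.
    under eq_bigr => b _ do rewrite WE.
    rewrite exchange_big; apply: eq_bigr => a _.
    rewrite exchange_big; apply: eq_bigr => a' _.
    by rewrite mulr_sumr.
  have cst : \sum_(a : X) \sum_(a' : X) (d ^+ 3 / 128 * y) =
      d ^+ 3 / 128 * x ^+ 2 * y.
    rewrite !sum_cst -/x; ring.
  have e0 : 0 <= d ^+ 3 / 128 * y.
    positivity.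
  rewrite -cst big_mkcond; apply: ler_sum => a _; case: ifP => _; last first.
    by rewrite sumr_ge0.
  rewrite big_mkcond; apply: ler_sum => a' _; case: ifP => _ //.
  by rewrite /bad; case: ltP => h; rewrite ?mul1r ?mul0r // ltW.
(* Dependent random choice: on average over b, the neighbourhood X2 b is large
   while few of its pairs have small codegree. *)
have [b hb] : exists b, W b + d ^+ 3 / 128 * x ^+ 2 <= d / 16 * n b ^+ 2.
  apply/existsP; apply: contraT; rewrite negb_exists => /forallP hW.
  pose m := d / 2 * x.
  have : \sum_b d / 16 * (2 * m * n b - m ^+ 2) <
         \sum_b (W b + d ^+ 3 / 128 * x ^+ 2).
    apply: ltr_sum => [|b _].
      by apply/hasP; case/card_gt0P: Y0 => b _; exists b; rewrite ?mem_index_enum.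
    have := hW b; rewrite -ltNge; apply: le_lt_trans.
    apply: ler_wpM2l; first by positivity.
    (* linearising the square replaces Cauchy-Schwarz *)
    have := sqr_ge0 (n b - m); rewrite sqrrB; lra.
  rewrite big_split /= -mulr_sumr sumrB -mulr_sumr sum_n.
  rewrite !sum_cst -/y => h.
  have h1 : d / 16 * (2 * m * (d / 2 * x * y) - m ^+ 2 * y) <=
            d / 16 * (2 * m * \sum_(a in X1) deg a - m ^+ 2 * y).
    apply: ler_wpM2l; first by positivity.
    rewrite lerD2r; apply: ler_wpM2l sum_deg1.
    rewrite /m; positivity.
  have := le_lt_trans h1 (lt_le_trans h (lerD sum_W (lexx _))).
  set l := (X in X < _); set r := (X in _ < X).
  have -> : l = r by rewrite /l /r /m; field.
  by rewrite ltxx.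
have W0 : 0 <= W b by rewrite sumr_ge0 // => a _; rewrite sumr_ge0.
(* As [W b] is nonnegative, the extra term in [hb] alone forces [n b ^+ 2] to be at least
   [d ^+ 2 / 8 * x ^+ 2]. *)
have n_ge : d / 4 * x <= n b.
  rewrite -(@ler_pXn2r _ 2) // ?nnegrE ?ler0n //; last first.
    positivity.
  rewrite -(ler_pM2l (divr_gt0 d0 (ltr0n _ 16))).
  apply: le_trans (le_trans _ hb) => //.
  have : 0 <= d ^+ 3 * x ^+ 2 by positivity.
  by rewrite !exprMn; lra.
have n0 : 0 < n b by apply: lt_le_trans n_ge; positivity.
have hW : W b <= d / 16 * n b ^+ 2.
  apply: le_trans hb; rewrite lerDl.
  positivity.
pose nbad a : R := \sum_(a' in X2 b) (bad a a')%:R.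
pose A := [set a in X2 b | nbad a <= d / 8 * n b].
pose nb b' : R := \sum_(a in X2 b) (G a b')%:R.
pose B := [set b' | d / 4 * n b <= nb b'].
exists A, B; split.
(* Markov: each vertex of [X2 b] outside [A] adds more than [d / 8 * n b] to [W b], so at most half
   of [X2 b] is lost. *)
- have : d / 8 * n b * (n b - #|A|%:R) <= W b.
    have -> : n b - #|A|%:R = #|X2 b :\: A|%:R.
      rewrite /n cardsDS; last by apply/subsetP => a; rewrite inE => /andP[].
      rewrite natrB //; apply: subset_leq_card.
      by apply/subsetP => a; rewrite inE => /andP[].
    rewrite mulr_natr -sumr_const /W.
    rewrite big_mkcond [leRHS]big_mkcond; apply: ler_sum => a _.
    rewrite in_setD [a \in A]inE; case: (a \in X2 b); rewrite ?andbF //= andbT.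
    rewrite -ltNge; case: ltP => [/ltW//|_].
    by rewrite sumr_ge0.
  move=> /le_trans/(_ hW).
  have -> : d / 16 * n b ^+ 2 = d / 8 * n b * (n b / 2) by field.
  rewrite ler_pM2l; last by positivity.
  by move: n_ge; lra.
(* Double count of the edges at [X2 b], whose vertices all lie in [X1]: a vertex outside [B]
   receives less than [d / 4 * n b] of them, one in [B] at most [n b]. *)
- have : d / 2 * y * n b <= \sum_b' nb b'.
    rewrite exchange_big mulr_natr -sumr_const; apply: ler_sum => a.
    by rewrite !inE => /andP[].
  have : \sum_b' nb b' <= \sum_b' (d / 4 * n b + (b' \in B)%:R * n b).
    apply: ler_sum => b' _; rewrite [b' \in B]inE.
    case: (lerP _ (nb b')) => h; last by rewrite mul0r addr0 ltW.
    rewrite mul1r -[nb b']add0r lerD //; first by positivity.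
    rewrite /nb sum_indicator ler_nat subset_leq_card //.
    by apply/subsetP => a; rewrite inE => /andP[].
  rewrite big_split /= sum_cst -/y -mulr_suml.
  have -> : \sum_(b' : Y) (b' \in B)%:R = #|B|%:R :> R.
    by rewrite sum_indicator; congr (_%:R); apply: eq_card => b'; rewrite inE.
  move=> h1 /le_trans/(_ h1) h2.
  rewrite -(ler_pM2r n0); lra.
- move=> a b'; rewrite !inE => /andP[_ ha] hb'.
  (* Discarding the bad partners of [a] among the neighbours [a'] of [b'] in [X2 b] leaves at least
     [nb b' - nbad a] choices of [a'], each with large codegree with [a]. *)
  have paths : d ^+ 3 / 128 * y * (nb b' - nbad a) <=
      #|[set p : X * Y | [&& G a p.2, G p.1 p.2 & G p.1 b']]|%:R.
    have -> : #|[set p : X * Y | [&& G a p.2, G p.1 p.2 & G p.1 b']]|%:R =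
        \sum_a' (G a' b')%:R * codeg a a'.
      under eq_bigr => a' _ do rewrite mulr_sumr.
      rewrite pair_bigA /= -[LHS](sum_indicator _ xpredT).
      apply: eq_bigr => -[a' b1] _ /=.
      by rewrite -natrM mulnb andbA andbC.
    rewrite /nb /nbad -sumrB mulr_sumr big_mkcond; apply: ler_sum => a' _.
    have cd : 0 <= codeg a a' by rewrite sumr_ge0.
    have e0 : 0 < d ^+ 3 / 128 * y by positivity.
    case: ifP => _; last by rewrite mulr_ge0.
    case: (G a' b'); rewrite /bad; case: (ltP (codeg a a')) => h;
      rewrite ?mul1r ?mul0r ?subr0 ?subrr ?mulr0 ?mulr1 // sub0r mulrN1 oppr_le0.
    exact: ltW.
  apply: le_trans paths.
  have -> : d ^+ 5 / 4096 * x * y = d ^+ 3 / 128 * y * (d / 8 * (d / 4 * x)).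
    by field.
  rewrite ler_pM2l; last by positivity.
  apply: (@le_trans _ _ (d / 8 * n b)); last by move: ha hb'; lra.
  by rewrite ler_pM2l // divr_gt0.
Qed.

(** * Dyadic levels, fibres and products *)

(** The top level [j] with [2 ^ j <= f x] already has [2 ^ j.+1] above [f x]; summing over [x] and
    averaging over the levels gives a good one. *)
Lemma dyadic_pigeonhole (T : finType) (f : T -> nat) (M : nat) :
  (0 < M)%N -> (forall x, (f x <= M)%N) ->
  exists2 j, (2 ^ j <= M)%N &
    (\sum_x f x <=
      (trunc_log 2 M).+1 * (2 ^ j.+1 * #|[set x | 2 ^ j <= f x]|))%N.
Proof.
move=> M0 fM; set L := (trunc_log 2 M).+1.
suff [j hj] : exists j : 'I_L,
    (\sum_x f x <= L * (2 ^ j.+1 * #|[set x | 2 ^ j <= f x]|))%N.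
  exists j => //; apply: leq_trans (trunc_logP (isT : 1 < 2)%N M0).
  by rewrite leq_exp2l // -ltnS.
apply/existsP; apply: contraT; rewrite negb_exists => /forallP small.
have pointwise x : (f x <= \sum_(j < L) 2 ^ j.+1 * (2 ^ j <= f x))%N.
  case: (posnP (f x)) => [->//|fx0].
  have jL : (trunc_log 2 (f x) < L)%N by rewrite ltnS leq_trunc_log.
  rewrite (bigD1 (Ordinal jL)) //= trunc_logP // muln1.
  by apply: leq_trans (leq_addr _ _); apply/ltnW/trunc_log_ltn.
have total : (\sum_x f x <= \sum_(j < L) 2 ^ j.+1 * #|[set x | 2 ^ j <= f x]|)%N.
  apply: leq_trans; first by apply: leq_sum => x _; exact: pointwise.
  rewrite exchange_big; apply: leq_sum => j _.
  rewrite -big_distrr /= leq_mul2l -sum1dep_card [leqRHS]big_mkcond /=.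
  apply/orP; right; apply: leq_sum => x _. by case: ifP.
have : (\sum_(j < L) L * (2 ^ j.+1 * #|[set x | 2 ^ j <= f x]|) <
        \sum_(j < L) \sum_x f x)%N.
  (* There is at least one level, and level 0 supplies the strict inequality. *)
  rewrite big_ord_recl [ltnRHS]big_ord_recl -addSn.
  apply: leq_add; first by have := small ord0; rewrite -ltnNge.
  by apply: leq_sum => j _; have := small (lift ord0 j); rewrite -ltnNge => /ltnW.
rewrite -big_distrr /= sum_nat_const card_ord ltn_mul2l /=.
by rewrite ltnNge total.
Qed.

Lemma card_image_fibers (T : finType) (V : choiceType) (h : T -> V)
    (D : {set T}) (t : nat) :
  {in D, forall x, (t <= #|[set y in D | h y == h x]|)%N} ->
  (t * #|` [fset h x | x in D] | <= #|D|)%N.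
Proof.
move=> fib; set S := [fset h x | x in D].
have -> : #|D| = (\sum_(s : S) #|[set y in D | h y == val s]|)%N.
  under eq_bigr => s _ do rewrite -sum1dep_card.
  rewrite -sum1_card (exchange_big_dep (mem D)) /=; last by move=> s y _ /andP[].
  apply: eq_bigr => y yD; have yS : h y \in S by apply/imfsetP; exists y.
  rewrite (bigD1 [` yS]) /= ?yD ?eqxx // big1 // => s /andP[/andP[_ /eqP e]].
  by case/eqP; apply: val_inj; rewrite /= e.
rewrite cardfE mulnC -sum_nat_const; apply: leq_sum => s _.
by have /imfsetP[x /= xD ->] := valP s; apply: fib.
Qed.

Lemma card_fsetM (K K' : choiceType) (A : {fset K}) (B : {fset K'}) :
  #|` A `*` B| = (#|` A| * #|` B|)%N.
Proof.
pose F (p : A * B) := (val p.1, val p.2).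
have F_inj : injective F by move=> [a b] [a' b'] [/val_inj -> /val_inj ->].
have -> : A `*` B = [fset F p | p in {: A * B}].
  apply/fsetP => -[a b]; rewrite in_fsetM /=.
  apply/andP/imfsetP => [[aA bB]|[[a' b'] /= _ [-> ->]]].
    by exists ([` aA], [` bB]).
  by split; apply: valP.
by rewrite card_imfset //= -cardE card_prod -!cardfE.
Qed.

(** * Sums along graph edges, and the energy *)

Section Sums.
Variables (V : zmodType) (X Y : finType) (f : X -> V) (g : Y -> V).
Hypotheses (f_inj : injective f) (g_inj : injective g).

Let h (p : X * Y) : V := f p.1 + g p.2.

Lemma card_reps_le (s : V) : (#|[set p | h p == s]| <= #|Y|)%N.
Proof.
have inj : {in [set p | h p == s] &, injective (@snd X Y)}.
  move=> [a b] [a' b']; rewrite !inE => /eqP e /eqP e' /= eb.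
  move: e e'; rewrite /h /= eb => <- /addIr/f_inj ->.
  by [].
by rewrite -(card_in_imset inj) max_card.
Qed.

(* f x + g y = (f x + g y') - (f x' + g y') + (f x' + g y), so the sum together
   with the inner vertices of a path is recovered from the three edge sums. *)
Lemma sumset_3paths (R : realFieldType) (G : X -> Y -> bool) (S : {fset V})
    (A : {set X}) (B : {set Y}) (P : R) :
  (forall a b, G a b -> f a + g b \in S) ->
  {in A & B, forall a b,
    P <= #|[set p : X * Y | [&& G a p.2, G p.1 p.2 & G p.1 b]]|%:R} ->
  #|` sumset [fset f a | a in A] [fset g b | b in B]|%:R * P
    <= #|` S|%:R ^+ 3.
Proof.
move=> GS paths; set W := sumset _ _.
(* [c] fixes one representation of each sum; its two entries are the endpoints of the paths counted
   for that sum. *)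
have /fin_all_exists[c cP] : forall s : W, exists p : X * Y,
    [/\ p.1 \in A, p.2 \in B & h p = val s].
  move=> s; have /imfset2P[_ /imfsetP[a /= aA ->] [_ /imfsetP[b /= bB ->] e]] :=
    valP s.
  by exists (a, b).
pose D := [set q : W * (X * Y) |
  [&& G (c q.1).1 q.2.2, G q.2.1 q.2.2 & G q.2.1 (c q.1).2]].
have le_D : #|` W|%:R * P <= #|D|%:R.
  have -> : #|D| = (\sum_(s : W) #|[set p : X * Y |
      [&& G (c s).1 p.2, G p.1 p.2 & G p.1 (c s).2]]|)%N.
    under eq_bigr => s _ do rewrite -sum1dep_card.
    by rewrite pair_big_dep /= sum1dep_card.
  rewrite natr_sum mulrC cardfE -sum_cst; apply: ler_sum => s _.
  by have [? ? _] := cP s; apply: paths.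
apply: le_trans le_D _.
pose F (q : W * (X * Y)) : V * (V * V) :=
  (f (c q.1).1 + g q.2.2, (f q.2.1 + g q.2.2, f q.2.1 + g (c q.1).2)).
have hE s x y :
    h (c s) = f (c s).1 + g y - (f x + g y) + (f x + g (c s).2).
  by rewrite /h [f x + g y]addrC addrKA addrA subrK.
have F_inj : {in D &, injective F}.
  move=> [s [x y]] [s' [x' y']] _ _ [/= e1 e2 e3].
  have es : s = s'.
    apply: val_inj; have [_ _ <-] := cP s; have [_ _ <-] := cP s'.
    by rewrite (hE s x y) e1 e2 e3 -hE.
  move: e1 e3; rewrite es => /addrI/g_inj -> /addIr/f_inj ->.
  by [].
have sub : [fset F q | q in D] `<=` S `*` (S `*` S).
  apply/fsubsetP => _ /imfsetP[q /= qD ->].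
  move: qD; rewrite !inE /= => /and3P[? ? ?].
  by rewrite !GS.
have := fsubset_leq_card sub.
rewrite card_in_imfset /= -?cardE; last first.
  by move=> p q; apply: F_inj.
by rewrite -natrX ler_nat !card_fsetM !expnS expn0 muln1.
Qed.

End Sums.

(** Reading a1 - a2 = b1 - b2 as a1 + b2 = a2 + b1 turns a quadruple into two representations, (a2,
    b1) and (a1, b2), of one sum. *)
Lemma energy_le_reps (V : zmodType) (A B : {fset V}) :
  (additive_energy A B <= \sum_(p : A * B)
    #|[set q : A * B | (val q.1 + val q.2 == val p.1 + val p.2 :> V)%R]|)%N.
Proof.
under eq_bigr => p _ do rewrite -sum1dep_card.
rewrite pair_big_dep /= sum1dep_card.
set D := [set q | _].
pose F (q : (A * B) * (A * B)) : (V * V) * (V * V) :=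
  ((val q.2.1, val q.1.1), (val q.1.2, val q.2.2)).
apply: (@leq_trans #|` [fset F q | q in D]|); last first.
  by rewrite (leq_trans (leq_imfset_card _ _ _)) // cardE.
apply: fsubset_leq_card; apply/fsubsetP => -[[a1 a2] [b1 b2]].
rewrite !inE /= => /andP[/andP[/andP[a1A a2A] /andP[b1B b2B]] /eqP e].
apply/imfsetP; exists (([` a2A], [` b1B]), ([` a1A], [` b2B])) => //=.
rewrite inE /=; apply/eqP.
by rewrite -[a1](subrK a2) e addrC addrA subrKC addrC.
Qed.

(** * Inequalities linking energy, edge density and sizes *)

Section EnergyArithmetic.
Variables (F : realFieldType) (K N L t e : F).
Hypotheses (K0 : 0 < K) (N0 : 0 < N) (L0 : 0 < L) (t0 : 0 < t).
Hypothesis energy_le : N ^+ 3 / K <= 2 * L * t * e.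

Lemma edges_gt0 : 0 < e.
Proof.
have : 0 < 2 * L * t * e by apply: lt_le_trans energy_le; positivity.
by rewrite pmulr_rgt0 //; positivity.
Qed.

Lemma density_ge : t <= N -> 1 <= 2 * L * K * (e / N ^+ 2).
Proof.
move=> tN; have e0 := edges_gt0.
have : N ^+ 3 / K <= 2 * L * N * e.
  apply: le_trans energy_le _; rewrite ler_pM2r // ler_pM2l //; positivity.
rewrite ler_pdivrMr // => h.
have N3 : 0 < N ^+ 3 by positivity.
rewrite -(ler_pM2l N3) mulr1; apply: le_trans h _.
rewrite le_eqVlt; apply/orP; left.
  by apply/eqP; field; rewrite gt_eqF.
Qed.
(** With d = e / N^2, multiplying the energy bound by [s] and using [t * s <= e] gives s <= 2 L K
    d^2 N. Cubing and dividing by d^5 N^2 / 4096 leaves 8 * 4096 = 32^3 and one factor d <= 1. *)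
Lemma sumset_size_le (s w : F) : 0 <= s -> t * s <= e -> e <= N ^+ 2 ->
  w * ((e / N ^+ 2) ^+ 5 / 4096 * N ^+ 2) <= s ^+ 3 ->
  w <= 32 ^+ 3 * L ^+ 3 * K ^+ 3 * N.
Proof.
move=> s0 ts eN; have e0 := edges_gt0.
have N3 : 0 < N ^+ 3 by positivity.
have s_le : s <= 2 * L * K * e ^+ 2 / N ^+ 3.
  have : s * (N ^+ 3 / K) <= 2 * L * e ^+ 2.
    apply: le_trans (ler_wpM2l s0 energy_le) _.
    have -> : s * (2 * L * t * e) = 2 * L * e * (t * s) by ring.
    have -> : 2 * L * e ^+ 2 = 2 * L * e * e by ring.
    by rewrite ler_pM2l //; positivity.
  rewrite mulrA ler_pdivrMr // ler_pdivlMr // => /le_trans; apply.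
  by rewrite le_eqVlt; apply/orP; left; apply/eqP; ring.
have d0 : 0 < (e / N ^+ 2) ^+ 5 / 4096 * N ^+ 2 by positivity.
rewrite -ler_pdivlMr // => /le_trans; apply.
rewrite ler_pdivrMr //.
apply: (@le_trans _ _ ((2 * L * K * e ^+ 2 / N ^+ 3) ^+ 3)).
  by rewrite lerXn2r // nnegrE //; positivity.
have -> : (2 * L * K * e ^+ 2 / N ^+ 3) ^+ 3 =
    8 * L ^+ 3 * K ^+ 3 * N * (e / N ^+ 2) ^+ 5 * e.
  by field; rewrite gt_eqF.
have -> : 32 ^+ 3 * L ^+ 3 * K ^+ 3 * N * ((e / N ^+ 2) ^+ 5 / 4096 * N ^+ 2) =
    8 * L ^+ 3 * K ^+ 3 * N * (e / N ^+ 2) ^+ 5 * N ^+ 2.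
  by field; rewrite gt_eqF.
by rewrite ler_pM2l //; positivity.
Qed.
End EnergyArithmetic.

(** * Embedded subsets and logarithms *)

Lemma card_imfset_val (T : choiceType) (A : {fset T}) (D : {set A}) :
  #|` [fset val a | a in D]| = #|D|.
Proof. by rewrite card_imfset //= -?cardE //; apply: val_inj. Qed.

Lemma imfset_val_sub (T : choiceType) (A : {fset T}) (D : {set A}) :
  [fset val a | a in D] `<=` A.
Proof. by apply/fsubsetP => _ /imfsetP[a /= _ ->]; apply: valP. Qed.

Lemma ln2_ge_half (R : realType) : 1 / 2 <= ln (2 : R).
Proof.
have : ln (1 - 2^-1 : R) <= - 2^-1 by apply: le_ln1Dx; lra.
have -> : 1 - 2^-1 = 2^-1 :> R by lra.
by rewrite lnV ?posrE // lerN2 div1r.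
Qed.

(** Bounds the number of dyadic levels: 2^j <= a and ln 2 >= 1/2 give j <= 2 ln a. *)
Lemma trunc_log_le_ln (R : realType) (b a : nat) : (0 < b)%N -> (b <= a)%N ->
  (trunc_log 2 b).+1%:R <= 2 * (1 + ln (a%:R : R)).
Proof.
move=> b0 ba; set j := trunc_log 2 b.
have a_ge : (2 : R) ^+ j <= a%:R.
  by rewrite -natrX ler_nat (leq_trans _ ba) // trunc_logP.
have : j%:R * ln (2 : R) <= ln (a%:R : R).
  rewrite mulr_natl -lnXn //.
  rewrite ler_ln ?posrE //; first by rewrite exprn_gt0.
  by apply: lt_le_trans a_ge; rewrite exprn_gt0.
have := ler_wpM2l (ler0n R j) (ln2_ge_half R).
rewrite -[j.+1%:R]natr1; move: (j%:R) (ln (2 : R)) (ln _) => x y z h1 h2; lra.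
Qed.

(** * Choice of the popular-sum graph and bookkeeping of the constants *)

Theorem proposition21 (R : realType) :
  exists C k : R, 0 < C /\ 0 < k /\
  forall (V : zmodType) (K : R) (A B : {fset V}),
    0 < K -> A != fset0 -> B != fset0 ->
    (#|` B| <= #|` A|)%N ->
    (additive_energy A B)%:R =
      ((#|` A|%:R * #|` B|%:R) `^ (3 / 2)) / K ->
    let Lambda : R := C * (1 + ln (#|` A|%:R)) `^ k in
    exists A' B' : {fset V},
      [/\ A' `<=` A, B' `<=` B,
          #|` A'|%:R >= Lambda^-1 * (#|` A|%:R / K) &
          #|` B'|%:R >= Lambda^-1 * (#|` B|%:R / K)] /\
      #|` sumset A' B'|%:R <=
         Lambda * K ^+ 3 * (#|` A|%:R * #|` B|%:R) `^ (1 / 2) /\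
      K ^+ 3 * (#|` A|%:R * #|` B|%:R) `^ (1 / 2) <=
         Lambda * K ^+ 4 * (#|` A'|%:R * #|` B'|%:R) `^ (1 / 2).
Proof.
(* The sumset bound costs [32 ^+ 3 * L ^+ 3], and [L] is at most twice 1 + ln |A|. *)
exists (64 ^+ 3), 3; split; first by rewrite exprn_gt0.
split=> //.
move=> V K A B K0 nzA nzB leBA energy Lambda.
have A0 : (0 < #|` A|)%N by rewrite cardfs_gt0.
have B0 : (0 < #|` B|)%N by rewrite cardfs_gt0.
pose h (p : A * B) : V := val p.1 + val p.2.
pose r (p : A * B) := #|[set q | h q == h p]|.
have rB p : (r p <= #|` B|)%N.
  by rewrite cardfE; apply: card_reps_le; apply: val_inj.
have [j jB jE] := dyadic_pigeonhole B0 rB.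
set L : R := (trunc_log 2 #|` B|).+1%:R.
set D := [set p | (2 ^ j <= r p)%N] in jE.
pose S := [fset h p | p in D].
(* [r] depends only on the sum, so [D] is a union of whole fibres of [h]. *)
have S_le : (2 ^ j * #|` S| <= #|D|)%N.
  apply: card_image_fibers => p; rewrite inE => pD; apply: leq_trans (pD) _.
  apply: subset_leq_card; apply/subsetP => q; rewrite !inE => /eqP e.
  by rewrite /r e eqxx andbT pD.
set a : R := #|` A|%:R in energy Lambda *.
set b : R := #|` B|%:R in energy *.
have a0 : 0 < a by rewrite ltr0n.
have b0 : 0 < b by rewrite ltr0n.
have ab0 : 0 < a * b by rewrite mulr_gt0.
pose N := (a * b) `^ (1 / 2).
have N0 : 0 < N by rewrite powR_gt0.
have N2 : N ^+ 2 = a * b.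
  by rewrite -powR_mulrn ?powR_ge0 // -powRrM mul1r mulVf ?pnatr_eq0 // powRr1 // ltW.
have N3 : N ^+ 3 = (a * b) `^ (3 / 2).
  by rewrite -powR_mulrn ?powR_ge0 // -powRrM mul1r [2^-1 * _]mulrC.
(* Here |B| <= |A| enters: the level [2 ^ j], at most |B|, is then at most [N], as the density bound
   requires. *)
have bN : b <= N.
  rewrite -(@ler_pXn2r _ 2) // ?nnegrE ?(ltW b0) ?(ltW N0) // N2 expr2 ler_pM2r //.
  by rewrite ler_nat.
have L0 : 0 < L by rewrite ltr0n.
have t0 : 0 < (2 ^ j)%:R :> R by rewrite ltr0n expn_gt0.
have tN : (2 ^ j)%:R <= N by apply: le_trans bN; rewrite ler_nat.
have energy_le : N ^+ 3 / K <= 2 * L * (2 ^ j)%:R * #|D|%:R.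
  rewrite N3 -energy.
  have -> : 2 * L * (2 ^ j)%:R * #|D|%:R =
      ((trunc_log 2 #|` B|).+1 * (2 ^ j.+1 * #|D|))%:R :> R.
    by rewrite expnS !natrM; ring.
  rewrite ler_nat; apply: leq_trans jE.
  exact: energy_le_reps.
have e_gt0 := edges_gt0 K0 N0 L0 t0 energy_le.
have d_ge := density_ge K0 N0 L0 t0 energy_le tN.
have e_le : #|D|%:R <= N ^+ 2.
  by rewrite N2 -natrM ler_nat !cardfE -card_prod max_card.
pose d := #|D|%:R / N ^+ 2.
have d0 : 0 < d by rewrite divr_gt0 ?exprn_gt0.
have edges : d * #|{: A}|%:R * #|{: B}|%:R <=
    #|[set p : A * B | (p.1, p.2) \in D]|%:R.
  rewrite -!cardfE -mulrA -/a -/b -N2 divfK ?gt_eqF ?exprn_gt0 //.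
  by rewrite ler_nat subset_leq_card //; apply/subsetP => -[x y] ?; rewrite inE.
have A0' : (0 < #|{: A}|)%N by rewrite -cardfE.
have B0' : (0 < #|{: B}|)%N by rewrite -cardfE.
have [A1 [B1 [A1_ge B1_ge paths]]] :=
  many_3paths (G := fun x y => (x, y) \in D) d0 A0' B0' edges.
rewrite -!cardfE -/a -/b in A1_ge B1_ge paths.
have GS x y : (x, y) \in D -> val x + val y \in S.
  by move=> xyD; apply/imfsetP; exists (x, y).
have sumset_le := sumset_3paths val_inj val_inj GS paths.
set A' := [fset val x | x in A1] in sumset_le.
set B' := [fset val y | y in B1] in sumset_le.
have L_le : L <= 2 * (1 + ln a) by apply: trunc_log_le_ln.
have L1 : 1 <= L by rewrite ler1n.
have LambdaE : Lambda = 32 ^+ 3 * (8 * (1 + ln a) ^+ 3).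
  rewrite /Lambda powR_mulrn; last by lra.
  by ring.
have Lambda_ge3 : 32 ^+ 3 * L ^+ 3 <= Lambda.
  rewrite LambdaE ler_pM2l ?exprn_gt0 //.
  have -> : 8 * (1 + ln a) ^+ 3 = (2 * (1 + ln a)) ^+ 3 by ring.
  by rewrite lerXn2r // nnegrE; lra.
(* The density is at least 1 / (2 L K), and [A1] has relative density at least d / 8, hence 16. *)
have Lambda_ge : 16 * L <= Lambda.
  apply: le_trans Lambda_ge3; apply: ler_pM => //; last exact: ler_eXnr.
  by apply: (@le_trans _ _ 32); [rewrite ler_nat | rewrite ler_eXnr // ler1n].
have Lambda0 : 0 < Lambda by apply: lt_le_trans Lambda_ge; rewrite mulr_gt0.
clearbody Lambda.
have d8 : Lambda^-1 / K <= d / 8.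
  rewrite -invfM -[leLHS]div1r ler_pdivrMr ?mulr_gt0 //.
  have := ler_wpM2r (ltW (mulr_gt0 K0 d0)) Lambda_ge.
  by move: d_ge; rewrite -/d; lra.
have A'_ge : Lambda^-1 * (a / K) <= #|` A'|%:R.
  rewrite card_imfset_val; apply: le_trans A1_ge.
  by rewrite mulrA mulrAC ler_pM2r.
have B'_ge : Lambda^-1 * (b / K) <= #|` B'|%:R.
  rewrite card_imfset_val; apply: le_trans B1_ge.
  rewrite mulrA mulrAC ler_pM2r //; apply: le_trans d8 _; lra.
exists A', B'; split; first by split=> //; apply: imfset_val_sub.
split.
  apply: (@le_trans _ _ (32 ^+ 3 * L ^+ 3 * K ^+ 3 * N)).
    have S_le' : (2 ^ j)%:R * #|` S|%:R <= #|D|%:R :> R by rewrite -natrM ler_nat.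
    apply: (sumset_size_le K0 N0 L0 t0 energy_le _ S_le' e_le) => //.
    by move: sumset_le; rewrite -[_ * a * b]mulrA -N2.
  by rewrite -/N ler_pM2r // ler_pM2r // exprn_gt0.
rewrite -/N.
(* The last claim, divided by [Lambda * K ^+ 4], is the geometric mean of the two lower bounds on
   |A'| and |B'|. *)
have : N / (Lambda * K) <= (#|` A'|%:R * #|` B'|%:R) `^ (1 / 2).
  have -> : N / (Lambda * K) =
      ((Lambda^-1 * (a / K)) * (Lambda^-1 * (b / K))) `^ (1 / 2).
    have -> : (Lambda^-1 * (a / K)) * (Lambda^-1 * (b / K)) =
        (N / (Lambda * K)) ^+ 2.
      rewrite expr_div_n N2; field.
      by rewrite !gt_eqF.
    by rewrite -powR_mulrn -?powRrM ?mul1r ?mulfV ?pnatr_eq0 ?powRr1 //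
      ltW // divr_gt0 // mulr_gt0.
  apply: ge0_ler_powR; rewrite ?nnegrE //.
  - by lra.
  - by positivity.
  - by positivity.
  - by apply: ler_pM => //; positivity.
have c0 : 0 < Lambda * K ^+ 4 by rewrite mulr_gt0 ?exprn_gt0.
rewrite -(ler_pM2l c0); apply: le_trans.
rewrite le_eqVlt; apply/orP; left; apply/eqP; field.
by rewrite !gt_eqF.
Qed.
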